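(* Let $\tilde E\subset\mathbb{R}^3$ be a normalized convex, cuboidal hexahedron (see context). Let the supplemental functions $\sigma_0,\dots,\sigma_5$ on $\tilde E$ be divergence-free, have vanishing normal flux on the faces $f_0,f_2,f_4$, and have normal fluxes $(\sigma_j\cdot\nu_1|_{f_1},\sigma_j\cdot\nu_3|_{f_3},\sigma_j\cdot\nu_5|_{f_5})$, $j=0,\dots,5$, given respectively by the rows of $$\begin{bmatrix} x_2-c_2^1&0&0\\ x_3-c_3^1&0&0\\ 0&x_1-c_1^3&0\\ 0&x_3-c_3^3&0\\ 0&0&x_1-c_1^5\\ 0&0&x_2-c_2^5 \end{bmatrix},$$ where $c_\ell^i$ is the average over face $f_i$ of the variable $x_\ell$. These provide independent flux degrees of freedom as long as the matrix $$\begin{bmatrix} c_1^1\nu_{1,1}&c_1^3\nu_{3,1}&c_1^5\nu_{5,1}\\ c_2^1\nu_{1,2}&c_2^3\nu_{3,2}&c_2^5\nu_{5,2}\\ c_3^1\nu_{1,3}&c_3^3\nu_{3,3}&c_3^5\nu_{5,3} \end{bmatrix}$$ is invertible.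
   Context: A convex, cuboidal hexahedron is a (nondegenerate) convex polyhedron in $\mathbb{R}^3$, combinatorially a cube, with six flat quadrilateral faces $f_0,\dots,f_5$, where $f_{2k}$ and $f_{2k+1}$ ($k=0,1,2$) are opposite, and vertices $\mathbf{x}_{ijk}=f_i\cap f_j\cap f_k$ with $i\in\{0,1\}$, $j\in\{2,3\}$, $k\in\{4,5\}$. $\nu_i=(\nu_{i,1},\nu_{i,2},\nu_{i,3})$ denotes the outer unit normal to $f_i$. Any such hexahedron can be mapped affinely to a normalized one $\tilde E$, for which $\mathbf{x}_{024}=0$, $\mathbf{x}_{124}=\mathbf{e}_1$, $\mathbf{x}_{034}=\mathbf{e}_2$, $\mathbf{x}_{025}=\mathbf{e}_3$ (standard basis vectors), so that $\nu_0=-\mathbf{e}_1$, $\nu_2=-\mathbf{e}_2$, $\nu_4=-\mathbf{e}_3$. $\mathbb{P}_1$ is the space of polynomials of degree at most 1 on $\mathbb{R}^3$, and $\mathbb{P}_1(f_i)$ the space of restrictions to $f_i$ (of dimension 3). The supplemental functions $\sigma_j$ are vector functions on $\tilde E$ with well-defined normal traces on the faces. That the six supplemental functions ''provide independent flux degrees of freedom'' means that, on the 18-dimensional space $\mathbb{P}_1^3\oplus\mathrm{span}\{\sigma_0,\dots,\sigma_5\}$, the normal flux map $\mathbf{u}\mapsto(\mathbf{u}\cdot\nu_0|_{f_0},\dots,\mathbf{u}\cdot\nu_5|_{f_5})$ is a bijection onto $\prod_{i=0}^5\mathbb{P}_1(f_i)$. *)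

(* Defs.v *)
From HB Require Import structures.
From mathcomp Require Import all_boot all_order all_algebra.
From mathcomp Require Import all_classical all_reals all_analysis.

Set Implicit Arguments.
Unset Strict Implicit.
Unset Printing Implicit Defensive.

Import Order.TTheory GRing.Theory Num.Theory.
Import numFieldNormedType.Exports.

Local Open Scope classical_set_scope.
Local Open Scope ring_scope.

(* The coordinates x_1, x_2, x_3 are the entries 0, 1, 2 of a row vector. *)
Notation space R := 'rV[R]_3.

Definition unit_vec (R : realType) (l : 'I_3) : space R := delta_mx 0 l.

(* The canonical norm of 'rV[R]_3 is the sup norm, so Euclidean notions are
   expressed through this product. *)
Definition dot (R : realType) (u w : space R) : R := \sum_(l < 3) u 0 l * w 0 l.

(* A vertex label (a, b, c) stands for x_{ijk} with i = 0 + a, j = 2 + b and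
   k = 4 + c. *)
Notation vlabel := (bool * bool * bool)%type.

Definition on_face (i : 'I_6) (w : vlabel) : bool :=
  let: (a, b, c) := w in nth false [:: ~~ a; a; ~~ b; b; ~~ c; c] i.

Definition hull (R : realType) (v : vlabel -> space R) (P : pred vlabel) :
    set (space R) :=
  [set x | exists t : vlabel -> R,
     [/\ forall w, 0 <= t w, forall w, ~~ P w -> t w = 0,
         \sum_w t w = 1 & x = \sum_w t w *: v w]].

Definition solid (R : realType) (v : vlabel -> space R) : set (space R) :=
  hull v predT.

Definition face (R : realType) (v : vlabel -> space R) (i : 'I_6) :
    set (space R) :=
  hull v (on_face i).

(* n is a unit vector, orthogonal to the plane of the four points labelled by
   face i, and the other four points lie strictly on the side opposite to n. *)
Definition outer_unit_normal (R : realType) (v : vlabel -> space R) (i : 'I_6)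
    (n : space R) : Prop :=
  dot n n = 1 /\
  forall w w', on_face i w ->
    if on_face i w' then dot n (v w' - v w) = 0 else dot n (v w' - v w) < 0.

(* Requiring every face i to be an exposed face of the convex hull that contains
   exactly its own four points forces the eight points to be distinct vertices
   (x_{ijk} is the only one on the faces i, j and k), no three of them
   collinear, and every intersection of adjacent faces to be an edge; each edge
   of a listed face thus lies on a second listed face, so the six planar
   quadrilaterals are all the facets and the polyhedron is combinatorially a
   cube with nonempty interior. *)
Definition convex_cuboidal_hexahedron (R : realType) (v : vlabel -> space R)
    (nu : 'I_6 -> space R) : Prop :=
  forall i, outer_unit_normal v i (nu i).

Definition normalized (R : realType) (v : vlabel -> space R) : Prop :=
  [/\ v (false, false, false) = 0,
      v (true, false, false) = unit_vec R 0,
      v (false, true, false) = unit_vec R 1 &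
      v (false, false, true) = unit_vec R 2].

(* The vertex of face i = 2k + odd i whose labels in the two directions other
   than k are s and t. *)
Definition face_label (i : 'I_6) (s t : bool) : vlabel :=
  nth (odd i, s, t) [:: (odd i, s, t); (s, odd i, t); (s, t, odd i)] i./2.

(* Affine coordinates on the plane of face i, based at one of its vertices and
   directed by the two edges at this vertex. *)
Definition face_edge1 (R : realType) (v : vlabel -> space R) (i : 'I_6) :
    space R :=
  v (face_label i true false) - v (face_label i false false).

Definition face_edge2 (R : realType) (v : vlabel -> space R) (i : 'I_6) :
    space R :=
  v (face_label i false true) - v (face_label i false false).

Definition face_param (R : realType) (v : vlabel -> space R) (i : 'I_6)
    (st : R * R) : space R :=
  v (face_label i false false)
  + st.1 *: face_edge1 v i + st.2 *: face_edge2 v i.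

Definition face_region (R : realType) (v : vlabel -> space R) (i : 'I_6) :
    set (R * R) :=
  face_param v i @^-1` face v i.

Definition leb2 (R : realType) := (@lebesgue_measure R \x @lebesgue_measure R)%E.

Definition leb3 (R : realType) := (@leb2 R \x @lebesgue_measure R)%E.

(* Constant area element |d_s X cross d_t X| of X = face_param v i, written with
   the Gram determinant of the two directions. *)
Definition face_area_element (R : realType) (v : vlabel -> space R) (i : 'I_6) :
    R :=
  let p := face_edge1 v i in let q := face_edge2 v i in
  Num.sqrt (dot p p * dot q q - dot p q ^+ 2).

Definition face_integral (R : realType) (v : vlabel -> space R) (i : 'I_6)
    (g : space R -> R) : R :=
  (\int[@leb2 R]_(st in face_region v i)
     (g (face_param v i st) * face_area_element v i))%R.

Definition face_average (R : realType) (v : vlabel -> space R) (i : 'I_6)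
    (g : space R -> R) : R :=
  face_integral v i g / face_integral v i (fun=> 1).

Definition face_centroid (R : realType) (v : vlabel -> space R) (i : 'I_6)
    (l : 'I_3) : R :=
  face_average v i (fun x => x 0 l).

(* "u . nu_i has the trace g on f_i": at almost every point of the face for the
   surface measure, g is the limit of u . nu_i from the interior of the solid.
   This covers fields that are only piecewise continuous, and does not depend on
   the values of u on the boundary. *)
Definition has_normal_trace (R : realType) (v : vlabel -> space R)
    (nu : 'I_6 -> space R) (i : 'I_6) (u : space R -> space R)
    (g : space R -> R) : Prop :=
  {ae @leb2 R, forall st, face_region v i st ->
     dot (u y) (nu i) @[y --> within (interior (solid v))
                                (nbhs (face_param v i st))]
       --> g (face_param v i st)}.

Definition has_normal_flux (R : realType) (v : vlabel -> space R)
    (nu : 'I_6 -> space R) (u : space R -> space R)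
    (g : 'I_6 -> space R -> R) : Prop :=
  forall i, has_normal_trace v nu i u (g i).

Fixpoint Ck (R : realType) (k : nat) (phi : space R -> R) : Prop :=
  continuous phi /\
  if k is k'.+1 then
    forall l, (forall x, derivable phi x (unit_vec R l)) /\
              Ck k' (fun x => 'D_(unit_vec R l) phi x)
  else True.

Definition test_function (R : realType) (U : set (space R))
    (phi : space R -> R) : Prop :=
  (forall k, Ck k phi) /\
  exists K : set (space R),
    [/\ compact K, K `<=` U & forall x, ~ K x -> phi x = 0].

Definition pt3 (R : realType) (z : R * R * R) : space R :=
  \row_l nth 0 [:: z.1.1; z.1.2; z.2] l.

(* Distributional sense, for locally integrable fields on the interior of A. *)
Definition divergence_free (R : realType) (A : set (space R))
    (u : space R -> space R) : Prop :=
  let U := interior A in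
  (forall K : set (space R), compact K -> K `<=` U -> forall l : 'I_3,
     (@leb3 R).-integrable (@pt3 R @^-1` K) (fun z => (u (pt3 z) 0 l)%:E)) /\
  (forall phi, test_function U phi ->
     (\int[@leb3 R]_(z in @pt3 R @^-1` U)
        (\sum_(l < 3) u (pt3 z) 0 l * 'D_(unit_vec R l) phi (pt3 z)))%R = 0).

Definition P1 (R : realType) : set (space R -> R) :=
  [set q | exists (a : R) (b : space R), q = (fun x => a + dot b x)].

Definition P1_field (R : realType) : set (space R -> space R) :=
  [set p | forall l : 'I_3, P1 (fun x => p x 0 l)].

Arguments P1 R : clear implicits.
Arguments P1_field R : clear implicits.

(* Functions on a subset A of space R are represented by functions on space R
   that vanish outside A, so that Leibniz equality is equality on A. *)
Definition restr (R : realType) (T : zmodType) (A : set (space R))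
    (f : space R -> T) : space R -> T :=
  patch (fun=> 0) A f.

Definition P1_faces (R : realType) (v : vlabel -> space R) :
    set ('I_6 -> space R -> R) :=
  [set g | forall i, exists2 q, P1 R q & g i = restr (face v i) q].

Definition enriched_field (R : realType) (sigma : 'I_6 -> space R -> space R)
    (p : space R -> space R) (a : 'I_6 -> R) : space R -> space R :=
  fun x => p x + \sum_j a j *: sigma j x.

Definition enriched_space (R : realType) (v : vlabel -> space R)
    (sigma : 'I_6 -> space R -> space R) : set (space R -> space R) :=
  [set u | exists p a,
     P1_field R p /\ u = restr (solid v) (enriched_field sigma p a)].

(* P_1^3 + span(sigma_0, ..., sigma_5) is a direct sum of dimension 12 + 6 on the solid. *)
Definition direct_enrichment (R : realType) (v : vlabel -> space R)
    (sigma : 'I_6 -> space R -> space R) : Prop :=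
  forall p a, P1_field R p ->
    (forall x, solid v x -> enriched_field sigma p a x = 0) ->
    (forall x, solid v x -> p x = 0) /\ (forall j, a j = 0).

(* The relation has_normal_flux is the graph of a bijection from the enriched
   space onto the product of the spaces P_1(f_i). *)
Definition independent_flux_dofs (R : realType) (v : vlabel -> space R)
    (nu : 'I_6 -> space R) (sigma : 'I_6 -> space R -> space R) : Prop :=
  [/\ direct_enrichment v sigma,
      forall u, enriched_space v sigma u ->
        exists! g, P1_faces v g /\ has_normal_flux v nu u g &
      forall g, P1_faces v g ->
        exists! u, enriched_space v sigma u /\ has_normal_flux v nu u g].

(* f_1, f_3, f_5 for m = 0, 1, 2. *)
Definition odd_face (m : 'I_3) : 'I_6 := inord m.*2.+1.

(* Row j, with one column for each of the faces f_1, f_3, f_5. *)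
Definition supplement_rows (R : realType) (v : vlabel -> space R) (x : space R) :
    seq (seq R) :=
  let c (i : 'I_6) (l : 'I_3) := face_centroid v i l in
  let f1 := odd_face 0 in let f3 := odd_face 1 in let f5 := odd_face 2 in
  [:: [:: x 0 1 - c f1 1; 0; 0];
      [:: x 0 2 - c f1 2; 0; 0];
      [:: 0; x 0 0 - c f3 0; 0];
      [:: 0; x 0 2 - c f3 2; 0];
      [:: 0; 0; x 0 0 - c f5 0];
      [:: 0; 0; x 0 1 - c f5 1]].

Definition supplement_flux (R : realType) (v : vlabel -> space R) (j i : 'I_6)
    (x : space R) : R :=
  if odd i then nth 0 (nth [::] (supplement_rows v x) j) i./2 else 0.

Definition centroid_normal_matrix (R : realType) (v : vlabel -> space R)
    (nu : 'I_6 -> space R) : 'M[R]_3 :=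
  \matrix_(l < 3, m < 3) (face_centroid v (odd_face m) l * nu (odd_face m) 0 l).

(* Main.v *)
Require Import Defs.
From HB Require Import structures.
From mathcomp Require Import all_boot all_order all_algebra.
From mathcomp Require Import all_classical all_reals all_analysis.
From mathcomp Require Import measurable_realfun.
From mathcomp Require Import ring lra.

Set Implicit Arguments.
Unset Strict Implicit.
Unset Printing Implicit Defensive.

Import Order.TTheory GRing.Theory Num.Theory.
Import numFieldNormedType.Exports.

Local Open Scope classical_set_scope.
Local Open Scope ring_scope.

(** Why the theorem is true. Traces are taken almost everywhere and from the
    interior, but interior points accumulate at every point of a face and an
    affine function that vanishes almost everywhere on a face vanishes on it.
    An enriched field p + sum_j a_j sigma_j thus has, on each face, exactly one
    affine flux, the function enriched_flux p a, which knows sigma_j only through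
    its prescribed flux (normal_trace_unique, enriched_normal_flux). Everything
    reduces to showing that the linear map from (p, a) to the affine fluxes on
    the six faces is injective and surjective.

    On the even faces, which lie in the coordinate planes, only p contributes,
    and the flux determines p up to a field (b_1 x_1, b_2 x_2, b_3 x_3). On an
    odd face the supplemental fluxes vanish at the centroid, and averaging an
    affine function is evaluating it at the centroid (face_average_P1). So the
    mean fluxes of this field on the odd faces are the entries of b times the
    given matrix, whose invertibility is solvability for b. What remains on an
    odd face is an affine function vanishing at the centroid; the outer normal
    has a positive component along the axis of the face, so its plane is a graph
    over the two other coordinates and such functions are exactly the
    combinations of the two supplemental fluxes (P1_centroid_span). This yields
    enriched_flux_inj and enriched_flux_surj.

    Averages make sense because each face is parametrized by a compact subset of
    the plane that contains a square, with a nonzero area element. *)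

(** * Axes, faces and vertices *)

Section Dot.
Variable R : realType.
Implicit Types (u x y : 'rV[R]_3) (m l : 'I_3).

(** Around an axis m, the two other axes in increasing order are lift m 0 and
    lift m 1; this is also the order in which faces are parametrized and in
    which the supplemental fluxes are listed. *)
Lemma sum_axes m (F : 'I_3 -> R) :
  \sum_l F l = F m + F (lift m 0) + F (lift m 1).
Proof.
rewrite (bigD1_ord m) //= big_ord_recl big_ord1 addrA.
by congr (_ + F _ + F _); apply: val_inj.
Qed.

Lemma axis_cases m l : [\/ l = m, l = lift m 0 | l = lift m 1].
Proof.
case: (unliftP m l) => [k ->|->]; last by constructor 1.
case: k => [[|[|//]] hk]; [constructor 2|constructor 3];
  by congr lift; apply: val_inj.
Qed.

Lemma axis_ext m x y : x 0 m = y 0 m -> x 0 (lift m 0) = y 0 (lift m 0) ->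
  x 0 (lift m 1) = y 0 (lift m 1) -> x = y.
Proof.
by move=> h0 h1 h2; apply/rowP => l; case: (axis_cases m l) => ->.
Qed.

Lemma dotDr u x y : dot u (x + y) = dot u x + dot u y.
Proof. by rewrite /dot -big_split; apply: eq_bigr => l _; rewrite mxE mulrDr. Qed.

Lemma dotZr u a x : dot u (a *: x) = a * dot u x.
Proof. by rewrite /dot mulr_sumr; apply: eq_bigr => l _; rewrite mxE mulrCA. Qed.

Lemma dotBr u x y : dot u (x - y) = dot u x - dot u y.
Proof. by rewrite dotDr -scaleN1r dotZr mulN1r. Qed.

Lemma dotC u x : dot u x = dot x u.
Proof. by apply: eq_bigr => l _; rewrite mulrC. Qed.

Lemma dot_sumr (I : finType) u (F : I -> 'rV[R]_3) :
  dot u (\sum_i F i) = \sum_i dot u (F i).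
Proof.
elim/big_ind2 : _ => [|x1 a1 x2 a2 <- <-|//]; last by rewrite dotDr.
by rewrite /dot big1 // => l _; rewrite mxE mulr0.
Qed.

Lemma dot_unit u m : dot u (unit_vec R m) = u 0 m.
Proof.
rewrite /dot (bigD1 m) //= big1 => [|l /negPf lm]; rewrite !mxE ?eqxx ?lm/=.
  by rewrite mulr1 addr0.
by rewrite mulr0.
Qed.

(** A plane is the graph of one coordinate over the two others. *)
Lemma plane_ext m (n : 'rV[R]_3) x y : n 0 m != 0 -> dot n (x - y) = 0 ->
  x 0 (lift m 0) = y 0 (lift m 0) -> x 0 (lift m 1) = y 0 (lift m 1) -> x = y.
Proof.
move=> nm nxy c1 c2; apply: (axis_ext _ c1 c2).
move: nxy; rewrite /dot (sum_axes m) !mxE c1 c2 !subrr !mulr0 !addr0 => /eqP.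
by rewrite mulf_eq0 (negPf nm) subr_eq0 => /eqP.
Qed.

End Dot.

Definition axis (i : 'I_6) : 'I_3 := inord i./2.

Definition axis_bit (w : bool * bool * bool) (m : 'I_3) : bool :=
  let: (a, b, c) := w in nth false [:: a; b; c] m.

Definition even_face (m : 'I_3) : 'I_6 := inord m.*2.

Lemma val_axis i : axis i = i./2 :> nat.
Proof. by rewrite inordK //; case: i => [[|[|[|[|[|[]]]]]]]. Qed.

Lemma val_odd_face m : odd_face m = m.*2.+1 :> nat.
Proof. by rewrite inordK //; case: m => [[|[|[]]]]. Qed.

Lemma val_even_face m : even_face m = m.*2 :> nat.
Proof. by rewrite inordK //; case: m => [[|[|[]]]]. Qed.

Lemma axis_odd_face m : axis (odd_face m) = m.
Proof. by apply: ord_inj; rewrite val_axis val_odd_face/= uphalf_double. Qed.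

Lemma axis_even_face m : axis (even_face m) = m.
Proof. by apply: ord_inj; rewrite val_axis val_even_face doubleK. Qed.

Lemma odd_odd_face m : odd (odd_face m).
Proof. by rewrite val_odd_face /= odd_double. Qed.

Lemma odd_even_face m : odd (even_face m) = false.
Proof. by rewrite val_even_face odd_double. Qed.

Lemma faceE (i : 'I_6) : i = if odd i then odd_face (axis i) else even_face (axis i).
Proof.
apply: ord_inj; case: ifP => oi; rewrite ?val_odd_face ?val_even_face val_axis.
  by rewrite -[LHS]odd_double_half oi.
by rewrite -[LHS]odd_double_half oi.
Qed.

Lemma on_faceE i w : on_face i w = (axis_bit w (axis i) == odd i).
Proof.
case: w => [[a b] c]; rewrite /axis_bit val_axis.
by case: i => [[|[|[|[|[|[|//]]]]]]] /= _; case: a; case: b; case: c.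
Qed.

Lemma axis_bit_label i s t :
  [/\ axis_bit (face_label i s t) (axis i) = odd i,
      axis_bit (face_label i s t) (lift (axis i) 0) = s &
      axis_bit (face_label i s t) (lift (axis i) 1) = t].
Proof.
rewrite /face_label /axis_bit.
case: i => [[|[|[|[|[|[|//]]]]]]] hi; rewrite /lift /bump !val_axis; by split.
Qed.

Lemma on_face_label i s t : on_face i (face_label i s t).
Proof. by rewrite on_faceE; case: (axis_bit_label i s t) => ->. Qed.

Section Geometry.
Variables (R : realType) (v : bool * bool * bool -> 'rV[R]_3).
Variable nu : 'I_6 -> 'rV[R]_3.
Hypothesis hexahedron_v : convex_cuboidal_hexahedron v nu.
Hypothesis normalized_v : normalized v.
Implicit Types (x y : 'rV[R]_3) (m l : 'I_3) (i : 'I_6).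

Let o : bool * bool * bool := (false, false, false).

Let axis_bit_o m : axis_bit o m = false.
Proof. by case: m => [[|[|[]]]]. Qed.

Let v_o : v o = 0. Proof. by case: normalized_v. Qed.

Lemma vertex_unit m : exists2 w, v w = unit_vec R m &
  forall l, axis_bit w l = (l == m).
Proof.
case: normalized_v => _ h1 h2 h3.
case: m => [[|[|[|//]]]] hm.
- exists (true, false, false); first by rewrite h1; congr unit_vec; apply: val_inj.
  by case => [[|[|[]]]].
- exists (false, true, false); first by rewrite h2; congr unit_vec; apply: val_inj.
  by case => [[|[|[]]]].
- exists (false, false, true); first by rewrite h3; congr unit_vec; apply: val_inj.
  by case => [[|[|[]]]].
Qed.

(** The face contains the origin and the unit vectors of the two other axes, so
    only the component along m can survive; the unit vector of m lies inside,
    which gives the sign. *)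
Lemma normal_even m : nu (even_face m) = - unit_vec R m.
Proof.
have [nn nP] := hexahedron_v (even_face m).
have oe : on_face (even_face m) o by rewrite on_faceE axis_bit_o odd_even_face.
have nl l : l != m -> nu (even_face m) 0 l = 0.
  move=> lm; have [w vw wP] := vertex_unit l.
  have := nP o w oe; rewrite on_faceE wP axis_even_face odd_even_face.
  by rewrite [m == l]eq_sym (negPf lm) /= v_o subr0 vw dot_unit.
have n0 : nu (even_face m) 0 m < 0.
  have [w vw wP] := vertex_unit m.
  have := nP o w oe; rewrite on_faceE wP axis_even_face odd_even_face.
  by rewrite eqxx /= v_o subr0 vw dot_unit.
have nm : nu (even_face m) 0 m = -1.
  move: nn; rewrite /dot (bigD1 m) //= big1 => [|l lm].
    by move: n0; set a := nu _ _ _ => a0 aa; nra.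
  by rewrite nl // mul0r.
apply/rowP => l; rewrite !mxE eqxx /=.
by have [->|lm] := eqVneq l m; rewrite ?nm // nl // oppr0.
Qed.

(** The vertices lie on or strictly inside the coordinate plane that carries the
    even face of each axis. *)
Lemma vertex_coord w m :
  if axis_bit w m then is_true (0 < v w 0 m) else v w 0 m = 0.
Proof.
have [_ nP] := hexahedron_v (even_face m).
have oe : on_face (even_face m) o by rewrite on_faceE axis_bit_o odd_even_face.
have := nP o w oe; rewrite on_faceE axis_even_face odd_even_face v_o subr0.
have -> : dot (nu (even_face m)) (v w) = - v w 0 m.
  rewrite normal_even dotC -scaleN1r dotZr dot_unit.
  by rewrite mulN1r.
by case: axis_bit => /= [|/eqP]; [rewrite oppr_lt0|rewrite oppr_eq0 => /eqP].
Qed.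

Lemma vertex_coord_ge0 w m : 0 <= v w 0 m.
Proof. by have := vertex_coord w m; case: axis_bit => [/ltW|->]. Qed.

(** The origin lies strictly inside the face through the unit vector of m. *)
Lemma normal_odd_gt0 m : 0 < nu (odd_face m) 0 m.
Proof.
have [w vw wP] := vertex_unit m.
have [_ nP] := hexahedron_v (odd_face m).
have := nP w o; rewrite !on_faceE axis_odd_face wP axis_bit_o odd_odd_face eqxx.
by move=> /(_ isT) /=; rewrite v_o sub0r vw -scaleN1r dotZr dot_unit mulN1r oppr_lt0.
Qed.

Lemma normal_axis_neq0 i : nu i 0 (axis i) != 0.
Proof.
rewrite (faceE i); case: ifP => _.
  by rewrite axis_odd_face gt_eqF ?normal_odd_gt0.
by rewrite normal_even axis_even_face !mxE !eqxx oppr_eq0 oner_eq0.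
Qed.

Lemma face_plane i w x : on_face i w -> face v i x -> dot (nu i) (x - v w) = 0.
Proof.
move=> iw [t [t0 tP t1 ->]]; have [_ nP] := hexahedron_v i.
have -> : \sum_w' t w' *: v w' - v w = \sum_w' t w' *: (v w' - v w).
  under [RHS]eq_bigr do rewrite scalerBr.
  by rewrite sumrB -scaler_suml t1 scale1r.
rewrite dot_sumr big1 // => w' _; rewrite dotZr.
have := nP w w' iw; case: (boolP (on_face i w')) => [_ ->|/tP -> _].
  by rewrite mulr0.
by rewrite mul0r.
Qed.

Lemma even_face_coord m x : face v (even_face m) x -> x 0 m = 0.
Proof.
have oe : on_face (even_face m) o by rewrite on_faceE axis_bit_o odd_even_face.
move=> /(face_plane oe); rewrite v_o subr0 normal_even dotC -scaleN1r dotZr dot_unit.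
by rewrite mulN1r => /eqP; rewrite oppr_eq0 => /eqP.
Qed.

Lemma hull_vertex (P : pred (bool * bool * bool)) w : P w -> hull v P (v w).
Proof.
move=> Pw; exists (fun w' => (w' == w)%:R); split.
- by move=> w'; exact: ler0n.
- by move=> w'; case: (eqVneq w' w) => [->|//]; rewrite Pw.
- by rewrite (bigD1 w) //= big1 ?eqxx ?addr0 // => w' /negPf ->.
- rewrite (bigD1 w) //= big1 ?eqxx ?scale1r ?addr0 // => w' /negPf ->.
  by rewrite scale0r.
Qed.

Lemma hull_convex (P : pred (bool * bool * bool)) x y a :
  0 <= a <= 1 -> hull v P x -> hull v P y -> hull v P (a *: x + (1 - a) *: y).
Proof.
move=> /andP[a0 a1] [s [s0 sP s1 ->]] [t [t0 tP t1 ->]].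
exists (fun w => a * s w + (1 - a) * t w); split.
- by move=> w; rewrite addr_ge0 // mulr_ge0 // subr_ge0.
- by move=> w wP; rewrite sP // tP // !mulr0 addr0.
- by rewrite big_split -!mulr_sumr /= s1 t1 !mulr1 addrC subrK.
- rewrite !scaler_sumr -big_split /=; apply: eq_bigr => w _.
  by rewrite [RHS]scalerDl !scalerA.
Qed.

Lemma face_sub_solid i : face v i `<=` solid v.
Proof. by move=> x [t [t0 _ t1 ->]]; exists t; split. Qed.

Lemma solid_coord x l : solid v x -> 0 <= x 0 l <= \sum_w v w 0 l.
Proof.
move=> [t [t0 _ t1 ->]]; rewrite summxE.
have tle1 w : t w <= 1.
  by rewrite -t1 (bigD1 w) //= lerDl sumr_ge0.
apply/andP; split.
  by apply: sumr_ge0 => w _; rewrite mxE mulr_ge0 // vertex_coord_ge0.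
by apply: ler_sum => w _; rewrite mxE ler_piMl // vertex_coord_ge0.
Qed.

Section Chart.
Variable i : 'I_6.
Let m := axis i.
Let p := face_edge1 v i.
Let q := face_edge2 v i.

Lemma face_base_coord :
  v (face_label i false false) 0 (lift m 0) = 0 /\
  v (face_label i false false) 0 (lift m 1) = 0.
Proof.
have [_ e1 e2] := axis_bit_label i false false.
have := vertex_coord (face_label i false false) (lift m 0).
have := vertex_coord (face_label i false false) (lift m 1).
by rewrite e1 e2.
Qed.

(** Each edge of the chart stays in one coordinate plane and leaves the other, so
    the chart is diagonal in the two coordinates other than the axis of the
    face. *)
Lemma face_edge_coord :
  [/\ 0 < p 0 (lift m 0), p 0 (lift m 1) = 0,
      q 0 (lift m 0) = 0 & 0 < q 0 (lift m 1)].
Proof.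
have [b1 b2] := face_base_coord.
have [_ e1 e2] := axis_bit_label i true false.
have [_ f1 f2] := axis_bit_label i false true.
have := vertex_coord (face_label i true false) (lift m 0).
have := vertex_coord (face_label i true false) (lift m 1).
have := vertex_coord (face_label i false true) (lift m 0).
have := vertex_coord (face_label i false true) (lift m 1).
rewrite e1 e2 f1 f2 /p /q /face_edge1 /face_edge2 => q1 q0 p1 p0.
by split; rewrite !mxE ?b1 ?b2 ?q0 ?p1 subr0.
Qed.

Lemma face_param_coord st :
  face_param v i st 0 (lift m 0) = st.1 * p 0 (lift m 0) /\
  face_param v i st 0 (lift m 1) = st.2 * q 0 (lift m 1).
Proof.
have [b1 b2] := face_base_coord; have [_ p1 q0 _] := face_edge_coord.
have coordE (b P Q : 'rV[R]_3) s t l :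
  (b + s *: P + t *: Q) 0 l = b 0 l + s * P 0 l + t * Q 0 l by rewrite !mxE.
rewrite /face_param !coordE -/p -/q b1 b2 p1 q0.
by rewrite !mulr0 addr0 !add0r.
Qed.

(** The two coordinates determine the parameters, and the plane of the face then
    determines the third coordinate because it is transversal to the axis. *)
Lemma face_paramK x : face v i x ->
  x = face_param v i (x 0 (lift m 0) / p 0 (lift m 0),
                      x 0 (lift m 1) / q 0 (lift m 1)).
Proof.
have [p0 p1 q0 q1] := face_edge_coord.
move=> fx; set st := (_, _).
have [x0 x1] := face_param_coord st.
have nx : dot (nu i) (x - v (face_label i false false)) = 0.
  by apply: face_plane => //; exact: on_face_label.
have ne w : on_face i w -> dot (nu i) (v w - v (face_label i false false)) = 0.
  by move=> iw; apply: face_plane (on_face_label _ _ _) _; exact: hull_vertex.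
have np : dot (nu i) (face_param v i st - v (face_label i false false)) = 0.
  rewrite /face_param addrAC [X in X + _]addrAC subrr add0r dotDr !dotZr.
  by rewrite !ne ?on_face_label // !mulr0 addr0.
have c1 : x 0 (lift m 0) = face_param v i st 0 (lift m 0).
  by rewrite x0 /= divfK // gt_eqF.
have c2 : x 0 (lift m 1) = face_param v i st 0 (lift m 1).
  by rewrite x1 /= divfK // gt_eqF.
apply: plane_ext (normal_axis_neq0 i) _ c1 c2.
have -> : x - face_param v i st =
    (x - v (face_label i false false)) -
    (face_param v i st - v (face_label i false false)).
  by rewrite opprB addrA subrK.
by rewrite dotBr nx np subrr.
Qed.

End Chart.
End Geometry.

(** * Lebesgue measure of the plane *)

Section PlaneMeasure.
Variable R : realType.

(** The product sigma-algebra of the plane is generated by boxes, so an open set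
    is measurable because countably many rational balls cover it. *)
Lemma open_measurable2 (U : set (R * R)) : open U -> measurable U.
Proof.
move=> oU.
pose rbox (c : rat * rat * rat) : set (R * R) :=
  ball (ratr c.1.1 : R) (ratr c.2) `*` ball (ratr c.1.2 : R) (ratr c.2).
pose F c := if `[< rbox c `<=` U >] then rbox c else set0.
suff -> : U = \bigcup_c F c.
  apply: countable_bigcupT_measurable => // c; rewrite /F; case: asboolP => // _.
  by rewrite /rbox !ball_itv; apply: measurableX; exact: measurable_itv.
rewrite eqEsubset; split => [z Uz|z [c _]]; last first.
  by rewrite /F; case: asboolP => // + /= ; exact.
have /nbhs_ballP[e /= e0 zeU] : nbhs z U by apply: open_nbhs_nbhs.
have [r] : exists r : rat, ratr r \in `]0, (e / 2)[%R.
  by apply: rat_in_itvoo; rewrite divr_gt0.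
rewrite in_itv/= => /andP[r0 re].
have near_rat (x : R) : exists p : rat, ball (ratr p : R) (ratr r) x.
  have [p] : exists p : rat, ratr p \in `](x - ratr r), (x + ratr r)[%R.
    by apply: rat_in_itvoo; lra.
  rewrite in_itv/= => /andP[h1 h2]; exists p.
  by rewrite /ball /= ltr_distl; apply/andP; split; lra.
have [p1 zp1] := near_rat z.1; have [p2 zp2] := near_rat z.2.
exists (p1, p2, r) => //; rewrite /F; case: asboolP => [_|]; first by split.
move=> []; move=> y [/= y1 y2]; apply: zeU.
have re2 : ratr r + ratr r <= e by lra.
split; apply: (le_ball re2).
  by apply: ball_triangle y1; exact: ball_sym.
by apply: ball_triangle y2; exact: ball_sym.
Qed.

Lemma closed_measurable2 (A : set (R * R)) : closed A -> measurable A.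
Proof.
by move=> cA; rewrite -[A]setCK; apply: measurableC; apply: open_measurable2;
  exact: closed_openC.
Qed.

Definition box (a b c d : R) : set (R * R) := `[a, b] `*` `[c, d].

Lemma measurable_box a b c d : measurable (box a b c d).
Proof. by apply: measurableX. Qed.

Lemma leb2_box a b c d : a <= b -> c <= d ->
  @leb2 R (box a b c d) = ((b - a) * (d - c))%:E.
Proof.
move=> ab cd; rewrite /leb2 /box product_measure1E //= EFinM.
have lenE (x y : R) : x <= y -> lebesgue_measure `[x, y]%classic = (y - x)%:E.
  rewrite lebesgue_measure_itv /= lte_fin le_eqVlt => /predU1P[->|->].
    by rewrite ltxx subrr.
  by rewrite -EFinD.
by rewrite !lenE.
Qed.

Lemma le_leb2 (A B : set (R * R)) : measurable A -> measurable B -> A `<=` B ->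
  (@leb2 R A <= @leb2 R B)%E.
Proof. by move=> mA mB AB; apply: le_measure; rewrite ?inE. Qed.

Lemma ae_leb2_filter : Filter (almost_everywhere (@leb2 R)).
Proof.
exact: (ae_filter_ringOfSetsType (lebesgue_measure \x lebesgue_measure)%E).
Qed.

(** A nondegenerate box has positive measure, so no null set contains it. *)
Lemma ae_meets_box (P : R * R -> Prop) a b c d : a < b -> c < d ->
  {ae @leb2 R, forall z, P z} -> exists2 z, box a b c d z & P z.
Proof.
move=> ab cd [N [mN N0 PN]].
suff [z bz nz] : exists2 z, box a b c d z & ~ N z.
  by exists z => //; apply: contrapT => nP; apply: nz; exact: PN.
apply: contrapT => noz.
have sub : box a b c d `<=` N.
  by move=> z bz; apply: contrapT => nz; apply: noz; exists z.
have : (@leb2 R (box a b c d) <= 0)%E.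
  by rewrite -N0; apply: le_leb2 => //; exact: measurable_box.
rewrite (leb2_box (ltW ab) (ltW cd)) lee_fin leNgt => /negP[].
by rewrite mulr_gt0 // subr_gt0.
Qed.

(** An affine function with zeros in small squares near three corners of a square
    vanishes, since three such points are never collinear. *)
Lemma ae_affine_eq0 (h : R * R -> R) (a b c : R) (P : R * R -> Prop) :
  (forall z, h z = a + z.1 * b + z.2 * c) ->
  (forall z, box 0 (2^-1) 0 (2^-1) z -> P z) ->
  {ae @leb2 R, forall z, P z -> h z = 0} -> forall z, h z = 0.
Proof.
move=> hE bP h0.
have zero (x y : R) : 0 <= x <= 2 / 5 -> 0 <= y <= 2 / 5 ->
    exists2 z, box x (x + 10^-1) y (y + 10^-1) z & h z = 0.
  move=> /andP[x0 x1] /andP[y0 y1].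
  have xx' : x < x + 10^-1 by lra.
  have yy' : y < y + 10^-1 by lra.
  have [z bz hz] := ae_meets_box xx' yy' h0; exists z => //; apply: hz.
  apply: bP; move: bz => [/=]; rewrite !in_itv /= => /andP[? ?] /andP[? ?].
  by split; rewrite /= in_itv /=; apply/andP; split; lra.
have [|| [s1 t1] [/= + +]] := zero 0 0; [lra|lra|].
rewrite !in_itv/= => /andP[? ?] /andP[? ?]; rewrite hE /= => z1.
have [|| [s2 t2] [/= + +]] := zero (2 / 5) 0; [lra|lra|].
rewrite !in_itv/= => /andP[? ?] /andP[? ?]; rewrite hE /= => z2.
have [|| [s3 t3] [/= + +]] := zero 0 (2 / 5); [lra|lra|].
rewrite !in_itv/= => /andP[? ?] /andP[? ?]; rewrite hE /= => z3.
(* Twice the signed area of the triangle of the three zeros. *)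
pose D := (s2 - s1) * (t3 - t1) - (s3 - s1) * (t2 - t1).
have Dpos : 0 < D by rewrite /D; nra.
have b0 : b = 0.
  have : D * b =
      (t3 - t1) * ((a + s2 * b + t2 * c) - (a + s1 * b + t1 * c)) -
      (t2 - t1) * ((a + s3 * b + t3 * c) - (a + s1 * b + t1 * c)).
    by rewrite /D; ring.
  rewrite z1 z2 z3 subrr !mulr0 subrr.
  by move/eqP; rewrite mulf_eq0 gt_eqF //= => /eqP.
have c0 : c = 0.
  have : D * c =
      (s2 - s1) * ((a + s3 * b + t3 * c) - (a + s1 * b + t1 * c)) -
      (s3 - s1) * ((a + s2 * b + t2 * c) - (a + s1 * b + t1 * c)).
    by rewrite /D; ring.
  rewrite z1 z2 z3 subrr !mulr0 subrr.
  by move/eqP; rewrite mulf_eq0 gt_eqF //= => /eqP.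
move=> z; rewrite hE b0 c0 !mulr0 !addr0.
by move: z1; rewrite b0 c0 !mulr0 !addr0.
Qed.

End PlaneMeasure.

(** * Affine functions and face averages *)

Section Affine.
Variable R : realType.
Implicit Types (q : 'rV[R]_3 -> R) (x y : 'rV[R]_3).

Lemma P1_cst a : P1 R (fun=> a).
Proof.
exists a, 0; apply/funext => x; rewrite /dot big1 ?addr0 // => l _.
by rewrite mxE mul0r.
Qed.

Lemma P1_coord l : P1 R (fun x => x 0 l).
Proof.
by exists 0, (unit_vec R l); apply/funext => x; rewrite add0r dotC dot_unit.
Qed.

Lemma P1D q q' : P1 R q -> P1 R q' -> P1 R (fun x => q x + q' x).
Proof.
move=> [a [b ->]] [a' [b' ->]]; exists (a + a'), (b + b'); apply/funext => x.
by rewrite (dotC (b + b')) dotDr !(dotC x) addrACA.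
Qed.

Lemma P1Z c q : P1 R q -> P1 R (fun x => c * q x).
Proof.
move=> [a [b ->]]; exists (c * a), (c *: b); apply/funext => x.
by rewrite (dotC (c *: b)) dotZr dotC mulrDr.
Qed.

Lemma P1B q q' : P1 R q -> P1 R q' -> P1 R (fun x => q x - q' x).
Proof.
move=> Pq Pq'; have := P1D Pq (P1Z (-1) Pq').
by congr (P1 R _); apply/funext => x; rewrite mulN1r.
Qed.

Lemma P1_sum (I : finType) (F : I -> 'rV[R]_3 -> R) :
  (forall i, P1 R (F i)) -> P1 R (fun x => \sum_i F i x).
Proof.
move=> PF; have -> : (fun x => \sum_i F i x) = \sum_i F i.
  by apply/funext => x; rewrite fct_sumE.
by elim/big_ind : _ => // [|f g]; [exact: P1_cst|exact: P1D].
Qed.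

Lemma P1_dot (p : 'rV[R]_3 -> 'rV[R]_3) (n : 'rV[R]_3) :
  P1_field R p -> P1 R (fun x => dot (p x) n).
Proof.
move=> Pp; apply: P1_sum => l; have := P1Z (n 0 l) (Pp l).
by congr (P1 R _); apply/funext => x; rewrite mulrC.
Qed.

Lemma continuous_sum (T : topologicalType) (V : normedModType R) (I : finType)
    (F : I -> T -> V) :
  (forall i, continuous (F i)) -> continuous (fun t => \sum_i F i t).
Proof.
move=> cF; have -> : (fun t => \sum_i F i t) = \sum_i F i.
  by apply/funext => t; rewrite fct_sumE.
elim/big_ind : _ => // [t|f g cf cg t]; first exact: cvg_cst.
by apply: continuousD; [exact: cf|exact: cg].
Qed.

Lemma continuous_scale (T : topologicalType) (f : T -> R) (a : 'rV[R]_3) :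
  continuous f -> continuous (fun t => f t *: a).
Proof. by move=> cf t; apply: cvgZr_tmp; exact: cf. Qed.

Lemma P1_continuous q : P1 R q -> continuous q.
Proof.
move=> [a [b ->]] x.
apply: (@continuousD R R^o _ (fun=> a) (dot b)); first exact: cst_continuous.
apply: (@continuous_sum _ R^o _ (fun l (y : 'rV[R]_3) => b 0 l * y 0 l)) => l y.
apply: (@continuousM _ _ (fun=> b 0 l) (fun y : 'rV[R]_3 => y 0 l)).
  exact: cst_continuous.
exact: coord_continuous.
Qed.

End Affine.

Section Hull.
Variable R : realType.

Import ArrowAsProduct.

(** The hull is the image of a standard simplex, a closed subset of a cube. *)
Lemma hull_compact (v : bool * bool * bool -> 'rV[R]_3) P : compact (hull v P).
Proof.
pose A w : set R := if P w then `[0, 1]%classic else [set 0].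
pose S := [set t : bool * bool * bool -> R | forall w, A w (t w)].
pose f (t : bool * bool * bool -> R) := \sum_w t w *: v w.
have cS : compact (S `&` (fun t => \sum_w t w) @^-1` [set 1]).
  apply: compact_closedI.
    apply: (@tychonoff _ (fun=> R) A) => w; rewrite /A; case: ifP => _.
      exact: segment_compact.
    exact: compact_set1.
  apply: preimage_closed; last exact: closed_eq.
  move=> t _; apply: (@continuous_sum R _ R^o) => w.
  exact: proj_continuous.
have -> : hull v P = f @` (S `&` (fun t => \sum_w t w) @^-1` [set 1]).
  rewrite eqEsubset; split => [x [t [t0 tP t1 ->]]|_ [t [tS t1] <-]].
    exists t => //; split=> // w; rewrite /A; case: ifP => [_|/negbT /tP //].
    rewrite /= in_itv /= t0 -t1 (bigD1 w) //= lerDl.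
    exact: sumr_ge0.
  exists t; split => // w.
    move: (tS w); rewrite /A; case: ifP => _ /=; last by move=> ->.
    by rewrite in_itv => /andP[].
  by move: (tS w); rewrite /A => + /negPf PF; rewrite PF.
apply: continuous_compact cS; apply: continuous_subspaceT.
pose T := prod_topology (fun _ : bool * bool * bool => R).
apply: (@continuous_sum _ T 'rV[R]_3 _ (fun w t => t w *: v w)) => w.
apply: (@continuous_scale _ T (fun t => t w)).
exact: (@proj_continuous _ (fun _ : bool * bool * bool => R) w).
Qed.

End Hull.

Section Region.
Variables (R : realType) (v : bool * bool * bool -> 'rV[R]_3).
Variable nu : 'I_6 -> 'rV[R]_3.
Hypothesis hexahedron_v : convex_cuboidal_hexahedron v nu.
Hypothesis normalized_v : normalized v.
Variable i : 'I_6.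

Let edges := face_edge_coord hexahedron_v normalized_v i.

Lemma P1_face_param q : P1 R q -> exists a b c, forall st,
  q (face_param v i st) = a + st.1 * b + st.2 * c.
Proof.
move=> [a [b ->]]; exists (a + dot b (v (face_label i false false))).
exists (dot b (face_edge1 v i)), (dot b (face_edge2 v i)) => st.
by rewrite /face_param 2!dotDr 2!dotZr !addrA.
Qed.

(** The parameters of the base vertex and of its two neighbours on the face are
    (0, 0), (1, 0) and (0, 1), and this square lies in their triangle. *)
Lemma box_sub_region : box 0 2^-1 0 2^-1 `<=` face_region v i.
Proof.
move=> [s t] [/=]; rewrite !in_itv /= => /andP[s0 s1] /andP[t0 t1].
have fv s' t' : face v i (v (face_label i s' t')).
  by apply: hull_vertex; exact: on_face_label.
have e1 : face v i (face_param v i (2 * s, 0)).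
  have -> : face_param v i (2 * s, 0) = (2 * s) *: v (face_label i true false) +
      (1 - 2 * s) *: v (face_label i false false).
    rewrite /face_param /face_edge1 scale0r addr0 scalerBr scalerBl scale1r.
    by rewrite addrCA.
  by apply: hull_convex; [lra|exact: fv|exact: fv].
have e2 : face v i (face_param v i (0, 2 * t)).
  have -> : face_param v i (0, 2 * t) = (2 * t) *: v (face_label i false true) +
      (1 - 2 * t) *: v (face_label i false false).
    rewrite /face_param /face_edge2 scale0r addr0 scalerBr scalerBl scale1r.
    by rewrite addrCA.
  by apply: hull_convex; [lra|exact: fv|exact: fv].
rewrite /face_region /preimage /=.
(* (s, t) is the midpoint of (2s, 0) and (0, 2t). *)
have -> : face_param v i (s, t) = 2^-1 *: face_param v i (2 * s, 0) +
    (1 - 2^-1) *: face_param v i (0, 2 * t).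
  apply/rowP => l; rewrite /face_param !mxE /=.
  by field.
by apply: hull_convex; [lra|exact: e1|exact: e2].
Qed.

Lemma face_param_continuous : continuous (face_param v i).
Proof.
move=> st; apply: cvgD; first apply: cvgD; first exact: cvg_cst.
  by apply: cvgZr_tmp; exact: cvg_fst.
by apply: cvgZr_tmp; exact: cvg_snd.
Qed.

Lemma measurable_face_region : measurable (face_region v i).
Proof.
apply: closed_measurable2; apply: preimage_closed.
  by move=> st _; exact: face_param_continuous.
by apply: compact_closed; [exact: norm_hausdorff|exact: hull_compact].
Qed.

(** The chart is diagonal in two coordinates, and coordinates are bounded on the
    solid. *)
Lemma face_region_bounded : exists2 M, 0 <= M & face_region v i `<=` box 0 M 0 M.
Proof.
have [p0 _ _ q1] := edges.
pose B l := \sum_w v w 0 l.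
have Bge l : 0 <= B l.
  by apply: sumr_ge0 => w _; exact: vertex_coord_ge0 hexahedron_v normalized_v _ _.
pose S := B (lift (axis i) 0) / face_edge1 v i 0 (lift (axis i) 0).
pose T := B (lift (axis i) 1) / face_edge2 v i 0 (lift (axis i) 1).
have S0 : 0 <= S by rewrite divr_ge0 // ltW.
have T0 : 0 <= T by rewrite divr_ge0 // ltW.
exists (S + T); first by rewrite addr_ge0.
move=> st fst; have sol := face_sub_solid fst.
have [c0 c1] := face_param_coord hexahedron_v normalized_v i st.
have /andP[l0] := solid_coord hexahedron_v normalized_v (lift (axis i) 0) sol.
have /andP[l1] := solid_coord hexahedron_v normalized_v (lift (axis i) 1) sol.
rewrite c0 c1 in l0 l1 *.
rewrite -!ler_pdivlMr // -/(B _) -/(B _) -/S -/T => t1 s1.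
move: l0 l1; rewrite !pmulr_lge0 // => s0 t0.
split; rewrite /= in_itv /=; apply/andP; split => //.
  by rewrite (le_trans s1) // lerDl.
by rewrite (le_trans t1) // lerDr.
Qed.

Lemma leb2_face_region_lty : (@leb2 R (face_region v i) < +oo)%E.
Proof.
have [M M0 sub] := face_region_bounded.
apply: (@le_lt_trans _ _ (@leb2 R (box 0 M 0 M))); last by rewrite leb2_box // ltry.
apply: le_leb2 => //; first exact: measurable_face_region.
exact: measurable_box.
Qed.

Lemma leb2_face_region_gt0 : (0 < @leb2 R (face_region v i))%E.
Proof.
apply: (@lt_le_trans _ _ (@leb2 R (box 0 2^-1 0 2^-1))).
  by rewrite leb2_box ?invr_ge0 // lte_fin subr0 mulr_gt0.
apply: le_leb2 box_sub_region; first exact: measurable_box.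
exact: measurable_face_region.
Qed.

Lemma P1_integrable q : P1 R q ->
  (@leb2 R).-integrable (face_region v i)
    (EFin \o (fun st => q (face_param v i st) * face_area_element v i)).
Proof.
move=> /P1_face_param[a [b [c qE]]].
have [M M0 sub] := face_region_bounded.
apply: measurable_bounded_integrable.
- exact: measurable_face_region.
- exact: leb2_face_region_lty.
- under eq_fun do rewrite qE.
  apply: measurable_funTS; apply: measurable_funM => //.
  apply: measurable_funD; first apply: measurable_funD => //.
    by apply: measurable_funM => //; exact: measurable_fst.
  by apply: measurable_funM => //; exact: measurable_snd.
- exists ((`|a| + M * `|b| + M * `|c|) * `|face_area_element v i|).
  split; first exact: num_real.
  move=> N /ltW MN st /sub[/=]; rewrite !in_itv /= => /andP[s0 s1] /andP[t0 t1].
  apply: le_trans MN; rewrite normrM ler_wpM2r // qE.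
  apply: (le_trans (ler_normD _ _)); apply: lerD.
    apply: (le_trans (ler_normD _ _)); apply: lerD => //.
    by rewrite normrM ler_wpM2r // ger0_norm.
  by rewrite normrM ler_wpM2r // ger0_norm.
Qed.

(** The Gram determinant is a sum of three squared minors, one of which is the
    product of the two nonzero diagonal entries of the chart. *)
Lemma face_area_element_gt0 : 0 < face_area_element v i.
Proof.
have [p0 p1 q0 q1] := edges.
rewrite sqrtr_gt0 /dot !(sum_axes (axis i)) p1 q0.
move: p0 q1; set P := face_edge1 v i 0 (lift (axis i) 0).
set Q := face_edge2 v i 0 (lift (axis i) 1).
set p := face_edge1 v i 0 (axis i); set q := face_edge2 v i 0 (axis i) => P0 Q0.
have -> : (p * p + P * P + 0 * 0) * (q * q + 0 * 0 + Q * Q) -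
    (p * q + P * 0 + 0 * Q) ^+ 2 = (p * Q) ^+ 2 + (P * q) ^+ 2 + (P * Q) ^+ 2.
  by ring.
by rewrite ltr_wpDl ?addr_ge0 ?sqr_ge0 // exprn_gt0 // mulr_gt0.
Qed.

Lemma face_integral1_neq0 : face_integral v i (fun=> 1) != 0.
Proof.
rewrite /face_integral Rintegral_cst; last exact: measurable_face_region.
rewrite mul1r mulf_neq0 ?gt_eqF ?face_area_element_gt0 //.
by rewrite fine_gt0 // leb2_face_region_gt0 leb2_face_region_lty.
Qed.

Lemma face_averageD q q' : P1 R q -> P1 R q' ->
  face_average v i (fun x => q x + q' x) = face_average v i q + face_average v i q'.
Proof.
move=> Pq Pq'; rewrite /face_average -mulrDl; congr (_ / _); rewrite /face_integral.
under eq_Rintegral do rewrite mulrDl.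
by rewrite RintegralD //; [exact: measurable_face_region| |]; exact: P1_integrable.
Qed.

Lemma face_averageZ c q : P1 R q ->
  face_average v i (fun x => c * q x) = c * face_average v i q.
Proof.
move=> Pq; rewrite /face_average mulrA; congr (_ / _); rewrite /face_integral.
under eq_Rintegral do rewrite -mulrA.
by rewrite RintegralZl //; [exact: measurable_face_region|exact: P1_integrable].
Qed.

Definition centroid : 'rV[R]_3 := \row_l face_centroid v i l.

(** The average is linear and normalized, so on affine functions it is evaluation
    at the centroid. *)
Lemma face_average_P1 q : P1 R q -> face_average v i q = q centroid.
Proof.
move=> [a [b ->]].
have sumE (x : 'rV[R]_3) : a + dot b x = a * 1 + b 0 0 * x 0 0 +
    b 0 (lift 0 0) * x 0 (lift 0 0) + b 0 (lift 0 1) * x 0 (lift 0 1).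
  by rewrite /dot (sum_axes 0) mulr1 !addrA.
under eq_fun do rewrite sumE.
have P1c l := P1Z (b 0 l) (@P1_coord R l); have P1a := P1Z a (@P1_cst R 1).
rewrite !face_averageD ?face_averageZ //;
  do ?[exact: P1_coord|exact: P1_cst|exact: P1D]; last first.
  by apply: P1D; [exact: P1D|exact: P1c].
rewrite sumE !mxE /face_average divff //; exact: face_integral1_neq0.
Qed.

(** Affine relations valid on a face pass to its centroid. Applied to the equation
    of the plane, it puts the centroid in the plane of the face. *)
Lemma P1_centroid_eq0 q : P1 R q -> (forall x, face v i x -> q x = 0) ->
  q centroid = 0.
Proof.
move=> Pq q0; rewrite -face_average_P1 // /face_average /face_integral.
rewrite (@eq_Rintegral _ _ _ _ _ (fun=> 0)); last first.
  by move=> st; rewrite inE => /q0 ->; rewrite mul0r.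
rewrite Rintegral_cst ?mul0r //; exact: measurable_face_region.
Qed.

End Region.

(** * Normal traces from the interior *)

Section InteriorClosure.
Variables (R : realType) (v : bool * bool * bool -> 'rV[R]_3).
Hypothesis normalized_v : normalized v.

(** The point x is the barycentre of the three points 3 x_l e_l, each on a
    segment from the origin to a vertex. *)
Lemma cube_sub_solid (x : 'rV[R]_3) : (forall l, 0 <= x 0 l <= 3^-1) -> solid v x.
Proof.
move=> xP; have [v0 v1 v2 v3] := normalized_v.
have axisP l c : 0 <= c <= 3^-1 -> solid v ((3 * c) *: unit_vec R l).
  move=> /andP[c0 c1].
  have -> : (3 * c) *: unit_vec R l = (3 * c) *: unit_vec R l + (1 - 3 * c) *: 0.
    by rewrite scaler0 addr0.
  apply: hull_convex; first lra.
    case: (axis_cases 0 l) => ->.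
    - by rewrite -v1; exact: hull_vertex.
    - have -> : lift 0 0 = 1 :> 'I_3 by apply: val_inj.
      by rewrite -v2; exact: hull_vertex.
    - have -> : lift 0 1 = 2 :> 'I_3 by apply: val_inj.
      by rewrite -v3; exact: hull_vertex.
  by rewrite -v0; exact: hull_vertex.
have -> : x = 3^-1 *: ((3 * x 0 0) *: unit_vec R 0) + (1 - 3^-1) *:
    (2^-1 *: ((3 * x 0 (lift 0 0)) *: unit_vec R (lift 0 0)) +
     (1 - 2^-1) *: ((3 * x 0 (lift 0 1)) *: unit_vec R (lift 0 1))).
  by apply: (@axis_ext _ 0); rewrite !mxE /=; field.
apply: hull_convex; [lra|exact: axisP|].
by apply: hull_convex; [lra|exact: axisP|exact: axisP].
Qed.

(** Shrinking a ball of the solid towards a point of the solid stays inside, by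
    convexity, so interior points accumulate at every point. *)
Lemma solid_sub_closure_interior : solid v `<=` closure (interior (solid v)).
Proof.
move=> x sx B /nbhs_ballP[e /= e0 xeB].
(* The centre of the cube of side 1/3 contained in the solid. *)
pose z : 'rV[R]_3 := const_mx 6^-1.
have zP : ball z 6^-1 `<=` solid v.
  move=> y [_ zy]; apply: cube_sub_solid => l; have := zy 0 l.
  rewrite /ball /= mxE ltr_distlC => /andP[h1 h2]; apply/andP; split; lra.
pose M := \sum_l `|z 0 l - x 0 l|.
have M0 : 0 <= M by exact: sumr_ge0.
have Ml l : `|z 0 l - x 0 l| <= M.
  by rewrite /M (bigD1 l) //= lerDl sumr_ge0.
(* A ratio in ]0, 1] that moves x towards z by less than e. *)
pose a := e / (e + M + 1).
have den0 : 0 < e + M + 1 by lra.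
have a0 : 0 < a by rewrite divr_gt0.
have a1 : a <= 1 by rewrite ler_pdivrMr // mul1r; lra.
have aM : a * M < e by rewrite mulrAC ltr_pdivrMr //; nra.
exists (a *: z + (1 - a) *: x); split; last first.
  apply: xeB; split=> // k l; rewrite (ord1 k) /ball /= !mxE.
  have -> : x 0 l - (a * 6^-1 + (1 - a) * x 0 l) = - (a * (6^-1 - x 0 l)) by ring.
  rewrite normrN normrM (gtr0_norm a0).
  have := Ml l; rewrite mxE => Ml'; apply: le_lt_trans aM.
  by rewrite ler_pM2l.
apply/nbhs_ballP; exists (a / 6); first by rewrite /= divr_gt0.
move=> y [_ by_]; pose w := a^-1 *: (y - (1 - a) *: x).
have -> : y = a *: w + (1 - a) *: x.
  by rewrite scalerA divff ?gt_eqF // scale1r subrK.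
apply: hull_convex; [lra| |exact: sx].
apply: zP; split=> [|k l]; first by rewrite invr_gt0.
have := by_ k l; rewrite (ord1 k) /ball /= !mxE.
have -> : a * 6^-1 + (1 - a) * x 0 l - y 0 l =
    a * (6^-1 - a^-1 * (y 0 l - (1 - a) * x 0 l)) by field; rewrite gt_eqF.
by rewrite normrM (gtr0_norm a0) ltr_pM2l.
Qed.

End InteriorClosure.

Section Trace.
Variables (R : realType) (v : bool * bool * bool -> 'rV[R]_3).
Variable nu : 'I_6 -> 'rV[R]_3.
Hypothesis hexahedron_v : convex_cuboidal_hexahedron v nu.
Hypothesis normalized_v : normalized v.

Lemma eq_normal_trace i u g g' : {in face v i, g =1 g'} ->
  has_normal_trace v nu i u g -> has_normal_trace v nu i u g'.
Proof.
move=> gg'; apply: (@filterS _ _ (ae_leb2_filter R)) => st ug fst.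
by rewrite -gg' ?inE //; exact: ug.
Qed.

(** Limits are unique because interior points accumulate at the face, so two
    affine traces agree almost everywhere on the face, hence everywhere. *)
Lemma normal_trace_unique i u g g' : P1 R g -> P1 R g' ->
  has_normal_trace v nu i u g -> has_normal_trace v nu i u g' ->
  forall x, face v i x -> g x = g' x.
Proof.
move=> Pg Pg' ug ug' x fx.
have [a [b [c hE]]] := P1_face_param v i (P1B Pg Pg').
rewrite (face_paramK hexahedron_v normalized_v fx); apply/eqP.
rewrite -subr_eq0; apply/eqP.
apply: (ae_affine_eq0 hE (@box_sub_region _ v i)).
apply: (@filterS2 _ _ (ae_leb2_filter R)) ug ug' => st ug ug' fst.
have := face_sub_solid fst.
move=> /(solid_sub_closure_interior normalized_v) /within_nbhs_proper ?.
apply/eqP; rewrite subr_eq0; apply/eqP.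
exact: cvg_unique (ug fst) (ug' fst).
Qed.

Variable sigma : 'I_6 -> 'rV[R]_3 -> 'rV[R]_3.
Hypothesis flux_sigma :
  forall j, has_normal_flux v nu (sigma j) (supplement_flux v j).

(** The pointwise normal flux that an enriched field has on a face; it depends on
    the supplemental functions through their prescribed fluxes alone. *)
Definition enriched_flux (p : 'rV[R]_3 -> 'rV[R]_3) (a : 'I_6 -> R) (i : 'I_6)
    (x : 'rV[R]_3) : R :=
  dot (p x) (nu i) + \sum_j a j * supplement_flux v j i x.

Lemma enriched_normal_flux p a u : P1_field R p ->
  (forall x, solid v x -> u x = enriched_field sigma p a x) ->
  has_normal_flux v nu u (enriched_flux p a).
Proof.
move=> Pp uE i.
have := filter_forall (ae_leb2_filter R) (fun j => flux_sigma j i).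
apply: (@filterS _ _ (ae_leb2_filter R)) => st sig fst.
set F := within _ _.
have FF : Filter F by exact: within_filter.
have lim : dot (p y) (nu i) + \sum_j a j * dot (sigma j y) (nu i) @[y --> F] -->
    enriched_flux p a i (face_param v i st).
  apply: cvgD.
    by apply: cvg_within_filter; exact: P1_continuous (P1_dot _ Pp) _.
  apply: cvg_big => [|j _]; first exact: add_continuous.
  by apply: cvgM; [exact: cvg_cst|exact: sig].
apply: cvg_trans lim; apply: near_eq_cvg.
near=> y.
have sy : solid v y.
  by apply: interior_subset; near: y; exact: withinT.
rewrite uE // /enriched_field [dot (_ + _) _]dotC dotDr dot_sumr (dotC (nu i) (p y)).
congr (_ + _).
by apply: eq_bigr => j _; rewrite dotZr (dotC (nu i)).
Unshelve. all: by end_near. Qed.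

End Trace.

(** * The linear system for the fluxes *)

Section SupplementaryFlux.
Variables (R : realType) (v : bool * bool * bool -> 'rV[R]_3).
Implicit Types (m : 'I_3) (x : 'rV[R]_3).

Lemma supplement_even j m x : supplement_flux v j (even_face m) x = 0.
Proof. by rewrite /supplement_flux odd_even_face. Qed.

Lemma half_odd_face m : (odd_face m)./2 = m.
Proof. by rewrite val_odd_face /= uphalf_double. Qed.

(** The two degrees of freedom of the face odd_face m have the indices
    even_face m and odd_face m. *)
Lemma supplement_sum (a : 'I_6 -> R) m x :
  let c := centroid v (odd_face m) in
  \sum_j a j * supplement_flux v j (odd_face m) x =
  a (even_face m) * (x 0 (lift m 0) - c 0 (lift m 0)) +
  a (odd_face m) * (x 0 (lift m 1) - c 0 (lift m 1)).
Proof.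
move=> c; rewrite {}/c !mxE.
under eq_bigr do rewrite /supplement_flux odd_odd_face half_odd_face.
rewrite !big_ord_recl big_ord0.
case: m => [[|[|[|//]]] hm] /=; rewrite ?mulr0 ?addr0 ?add0r;
  (congr (a _ * (x 0 _ - face_centroid v _ _) + a _ * (x 0 _ - face_centroid v _ _));
   try congr odd_face; apply: val_inj;
   rewrite ?[val (odd_face _)]val_odd_face ?[val (even_face _)]val_even_face //).
Qed.

Lemma supplement_P1 j i : P1 R (supplement_flux v j i).
Proof.
rewrite /supplement_flux; case: (odd i); last exact: P1_cst.
have Pc l c : P1 R (fun x => x 0 l - c).
  by apply: P1B; [exact: P1_coord|exact: P1_cst].
case: j => [[|[|[|[|[|[|//]]]]]] ?] /=;
  case: (i./2) => [|[|[|[|?]]]] /=; by [exact: Pc|exact: P1_cst].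
Qed.

End SupplementaryFlux.

Section Algebra.
Variables (R : realType) (v : bool * bool * bool -> 'rV[R]_3).
Variable nu : 'I_6 -> 'rV[R]_3.
Hypothesis hexahedron_v : convex_cuboidal_hexahedron v nu.
Hypothesis normalized_v : normalized v.
Hypothesis invertible : centroid_normal_matrix v nu \in unitmx.
Implicit Types (m l : 'I_3) (x : 'rV[R]_3) (q : 'rV[R]_3 -> R).

Let cen m := centroid v (odd_face m).

Lemma enriched_flux_P1 p a i : P1_field R p -> P1 R (enriched_flux v nu p a i).
Proof.
move=> Pp; apply: P1D; first exact: P1_dot.
by apply: P1_sum => j; apply: P1Z; exact: supplement_P1.
Qed.

Lemma enriched_flux_even p a m x :
  enriched_flux v nu p a (even_face m) x = - p x 0 m.
Proof.
rewrite /enriched_flux big1 => [|j _]; last by rewrite supplement_even mulr0.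
by rewrite addr0 (normal_even hexahedron_v normalized_v) -scaleN1r dotZr
  dot_unit mulN1r.
Qed.

Lemma enriched_flux_odd p a m x : enriched_flux v nu p a (odd_face m) x =
  dot (p x) (nu (odd_face m)) +
  (a (even_face m) * (x 0 (lift m 0) - cen m 0 (lift m 0)) +
   a (odd_face m) * (x 0 (lift m 1) - cen m 0 (lift m 1))).
Proof. by rewrite /enriched_flux supplement_sum. Qed.

(** The face spans the coordinate plane where x_m vanishes. *)
Lemma P1_eq0_even_face m q : P1 R q ->
  (forall x, face v (even_face m) x -> q x = 0) ->
  forall x, q x = q (unit_vec R m) * x 0 m.
Proof.
move=> [a [b ->]] q0 x.
have a0 : a = 0.
  have := q0 (v (false, false, false)).
  rewrite (_ : v _ = 0); last by case: normalized_v.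
  rewrite /dot big1 ?addr0 => [|l _]; last by rewrite mxE mulr0.
  apply; have [<- _ _ _] := normalized_v; apply: hull_vertex.
  by rewrite on_faceE odd_even_face; case: (axis _) => [[|[|[]]]].
have b0 l : l != m -> b 0 l = 0.
  move=> lm; have [w vw wP] := vertex_unit normalized_v l.
  have := q0 (v w); rewrite vw dot_unit a0 add0r; apply.
  rewrite -vw; apply: hull_vertex.
  by rewrite on_faceE odd_even_face axis_even_face wP [m == l]eq_sym (negPf lm).
rewrite a0 !add0r dot_unit {1}/dot (bigD1 m) //= big1 ?addr0 // => l /b0 ->.
by rewrite mul0r.
Qed.

Lemma centroid_plane m x : face v (odd_face m) x ->
  dot (nu (odd_face m)) (x - cen m) = 0.
Proof.
move=> fx; pose w := face_label (odd_face m) false false.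
have pl y : face v (odd_face m) y ->
    dot (nu (odd_face m)) y - dot (nu (odd_face m)) (v w) = 0.
  by rewrite -dotBr; apply: face_plane => //; exact: on_face_label.
have Pq : P1 R (fun y => dot (nu (odd_face m)) y - dot (nu (odd_face m)) (v w)).
  apply: P1B; last exact: P1_cst.
  by exists 0, (nu (odd_face m)); apply/funext => y; rewrite add0r.
have /= cP := P1_centroid_eq0 hexahedron_v normalized_v Pq pl.
have -> : x - cen m = (x - v w) - (cen m - v w) by rewrite opprB addrA subrK.
by rewrite dotBr (dotBr _ x) pl // dotBr cP subrr.
Qed.

(** On a plane through the centroid transversal to the axis m, two coordinates
    centred at the centroid span the affine functions vanishing there. *)
Lemma P1_centroid_span m q : P1 R q -> q (cen m) = 0 ->
  exists st : R * R, forall x, face v (odd_face m) x ->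
    q x = st.1 * (x 0 (lift m 0) - cen m 0 (lift m 0)) +
          st.2 * (x 0 (lift m 1) - cen m 0 (lift m 1)).
Proof.
move=> [a [b ->]] qc; pose n := nu (odd_face m).
have nm : n 0 m != 0.
  by rewrite gt_eqF // /n (normal_odd_gt0 hexahedron_v normalized_v).
exists (b 0 (lift m 0) - b 0 m * n 0 (lift m 0) / n 0 m,
        b 0 (lift m 1) - b 0 m * n 0 (lift m 1) / n 0 m) => x fx /=.
have -> : a + dot b x = dot b (x - cen m).
  by rewrite dotBr -[LHS]subr0 -qc; ring.
have /eqP := centroid_plane fx.
rewrite -/n /dot !(sum_axes m).
have subE l : (x - cen m) 0 l = x 0 l - cen m 0 l by rewrite mxE [X in _ + X]mxE.
rewrite !subE -!addrA addr_eq0 => /eqP e.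
have -> : x 0 m - cen m 0 m =
    - (n 0 (lift m 0) * (x 0 (lift m 0) - cen m 0 (lift m 0)) +
       n 0 (lift m 1) * (x 0 (lift m 1) - cen m 0 (lift m 1))) / n 0 m.
  by rewrite -e mulrAC divff // mul1r.
by field.
Qed.

(** Zero flux on the three coordinate planes reduces the affine field to
    (b_1 x_1, b_2 x_2, b_3 x_3). Evaluating the flux on an odd face at its
    centroid kills the supplemental terms and leaves one column of the product of
    b with the centroid matrix, so b = 0. The two supplemental fluxes that remain
    on each odd face are separated by the edges at its base vertex. *)
Lemma enriched_flux_inj p a : P1_field R p ->
  (forall i x, face v i x -> enriched_flux v nu p a i x = 0) ->
  (forall x, p x = 0) /\ (forall j, a j = 0).
Proof.
move=> Pp f0.
have pE x l : p x 0 l = p (unit_vec R l) 0 l * x 0 l.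
  apply: (P1_eq0_even_face (Pp l)) => y /f0.
  by rewrite enriched_flux_even => /eqP; rewrite oppr_eq0 => /eqP.
pose b := \row_l p (unit_vec R l) 0 l.
have b0 : b = 0.
  apply: (row_free_inj (A := centroid_normal_matrix v nu)).
    by rewrite row_free_unit.
  rewrite mul0mx; apply/rowP => m.
  have := P1_centroid_eq0 hexahedron_v normalized_v
            (enriched_flux_P1 _ _ Pp) (f0 (odd_face m)).
  rewrite enriched_flux_odd !subrr !mulr0 !addr0 => e.
  rewrite !mxE -[RHS]e; apply: eq_bigr => l _.
  rewrite !mxE (pE (centroid v (odd_face m))).
  by rewrite [centroid _ _ _ _]mxE mulrA.
have p0 x : p x = 0.
  apply/rowP => l; rewrite pE mxE.
  by have /rowP/(_ l) := b0; rewrite !mxE => ->; rewrite mul0r.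
split=> // j.
suff am m : a (even_face m) = 0 /\ a (odd_face m) = 0.
  by rewrite (faceE j); case: ifP => _; case: (am (axis j)).
pose w := face_label (odd_face m).
have fv s t : a (even_face m) * (v (w s t) 0 (lift m 0) - cen m 0 (lift m 0)) +
              a (odd_face m) * (v (w s t) 0 (lift m 1) - cen m 0 (lift m 1)) = 0.
  have := f0 (odd_face m) (v (w s t)); rewrite enriched_flux_odd p0.
  rewrite {1}/dot big1 ?add0r => [|l _]; last by rewrite mxE mul0r.
  by apply; apply: hull_vertex; exact: on_face_label.
have [] := face_edge_coord hexahedron_v normalized_v (odd_face m).
rewrite axis_odd_face /face_edge1 /face_edge2 !mxE -/(w _ _).
move=> p1 p2 q1 q2.
split.
  have := congr2 (fun s t : R => s - t) (fv true false) (fv false false).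
  rewrite /= subrr => e.
  have : a (even_face m) *
      (v (w true false) 0 (lift m 0) - v (w false false) 0 (lift m 0)) +
    a (odd_face m) *
      (v (w true false) 0 (lift m 1) - v (w false false) 0 (lift m 1)) = 0.
    by rewrite -[RHS]e; ring.
  rewrite p2 mulr0 addr0 => /eqP.
  by rewrite mulf_eq0 (gt_eqF p1) orbF => /eqP.
have := congr2 (fun s t : R => s - t) (fv false true) (fv false false).
rewrite /= subrr => e.
have : a (even_face m) *
    (v (w false true) 0 (lift m 0) - v (w false false) 0 (lift m 0)) +
  a (odd_face m) *
    (v (w false true) 0 (lift m 1) - v (w false false) 0 (lift m 1)) = 0.
  by rewrite -[RHS]e; ring.
rewrite q1 mulr0 add0r => /eqP.
by rewrite mulf_eq0 (gt_eqF q2) orbF => /eqP.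
Qed.

(** The even faces prescribe the affine field up to a term
    (b_1 x_1, b_2 x_2, b_3 x_3). Inverting the centroid matrix gives the b for
    which the flux is right at the centroids of the odd faces, and the
    supplemental fluxes correct what is left, an affine function vanishing
    there. *)
Lemma enriched_flux_surj (q : 'I_6 -> 'rV[R]_3 -> R) : (forall i, P1 R (q i)) ->
  exists p a, P1_field R p /\
    forall i x, face v i x -> enriched_flux v nu p a i x = q i x.
Proof.
move=> Pq.
(* The flux on an odd face minus the part of the field that the even faces fix. *)
pose h m x := q (odd_face m) x + \sum_l nu (odd_face m) 0 l * q (even_face l) x.
have Ph m : P1 R (h m).
  by apply: P1D => //; apply: P1_sum => l; exact: P1Z.
pose b := (\row_m h m (cen m)) *m invmx (centroid_normal_matrix v nu).
have bE m : \sum_l b 0 l * (cen m 0 l * nu (odd_face m) 0 l) = h m (cen m).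
  have /rowP/(_ m) : b *m centroid_normal_matrix v nu = \row_m h m (cen m).
    by rewrite mulmxKV.
  rewrite [in RHS]mxE mxE => <-; apply: eq_bigr => l _.
  by rewrite [centroid_normal_matrix _ _ _ _]mxE /cen [centroid _ _ _ _]mxE.
pose r m x := h m x - \sum_l b 0 l * (x 0 l * nu (odd_face m) 0 l).
have Pr m : P1 R (r m).
  apply: P1B => //; apply: P1_sum => l; apply: P1Z.
  have := P1Z (nu (odd_face m) 0 l) (@P1_coord R l).
  by congr (P1 R _); apply/funext => x; rewrite mulrC.
have rc m : r m (cen m) = 0 by rewrite /r bE subrr.
have [st stP] := choice (fun m => P1_centroid_span (Pr m) (rc m)).
pose p x : 'rV[R]_3 := \row_l (b 0 l * x 0 l - q (even_face l) x).
exists p, (fun j : 'I_6 => if odd j then (st (axis j)).2 else (st (axis j)).1).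
split.
  move=> l; have -> : (fun x => p x 0 l) =
      (fun x => b 0 l * x 0 l - q (even_face l) x).
    by apply/funext => x; rewrite mxE.
  by apply: P1B => //; apply: P1Z; exact: P1_coord.
move=> i x; rewrite (faceE i); case: ifP => _ fx.
  set m := axis i in fx *.
  rewrite enriched_flux_odd odd_even_face odd_odd_face axis_even_face axis_odd_face.
  rewrite -stP // /r /h {1}/dot.
  under eq_bigr do rewrite mxE mulrBl -mulrA.
  rewrite sumrB.
  under [X in _ - X]eq_bigr do rewrite mulrC.
  by ring.
rewrite enriched_flux_even mxE (even_face_coord hexahedron_v normalized_v fx).
by rewrite mulr0 sub0r opprK.
Qed.

End Algebra.

Lemma restr_in (R : realType) (T : zmodType) (A : set 'rV[R]_3)
    (f : 'rV[R]_3 -> T) (x : 'rV[R]_3) :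
  A x -> restr A f x = f x.
Proof. by move=> Ax; rewrite /restr patchT // inE. Qed.

Lemma eq_restr (R : realType) (T : zmodType) (A : set 'rV[R]_3)
    (f g : 'rV[R]_3 -> T) :
  (forall x, A x -> f x = g x) -> restr A f = restr A g.
Proof.
move=> fg; apply/funext => x; rewrite /restr /patch.
by case: ifPn => // /[!inE]; exact: fg.
Qed.

Theorem theorem2 (R : realType) (v : bool * bool * bool -> 'rV[R]_3)
    (nu : 'I_6 -> 'rV[R]_3) (sigma : 'I_6 -> 'rV[R]_3 -> 'rV[R]_3)
    (hexahedron_v : convex_cuboidal_hexahedron v nu)
    (normalized_v : normalized v)
    (div_sigma : forall j, divergence_free (solid v) (sigma j))
    (flux_sigma : forall j, has_normal_flux v nu (sigma j) (supplement_flux v j))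
    (invertible : centroid_normal_matrix v nu \in unitmx) :
  independent_flux_dofs v nu sigma.
Proof.
have traceU := normal_trace_unique hexahedron_v normalized_v.
have fluxP1 p a i := @enriched_flux_P1 R v nu p a i.
have trace p a u := @enriched_normal_flux R v nu sigma flux_sigma p a u.
have traceR p a : P1_field R p ->
    has_normal_flux v nu (restr (solid v) (enriched_field sigma p a))
      (enriched_flux v nu p a).
  by move=> Pp; apply: trace => // x; exact: restr_in.
(* Coefficients are determined by the fluxes on the faces. *)
have inj p a p' a' : P1_field R p -> P1_field R p' ->
    (forall i x, face v i x ->
       enriched_flux v nu p a i x = enriched_flux v nu p' a' i x) ->
    (forall x, p x = p' x) /\ (forall j, a j = a' j).
  move=> Pp Pp' e.
  have Pd : P1_field R (fun x => p x - p' x).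
    move=> l; have := P1B (Pp l) (Pp' l).
    by congr (P1 R _); apply/funext => x; rewrite !mxE.
  have [] := @enriched_flux_inj R v nu hexahedron_v normalized_v invertible
    (fun x => p x - p' x) (fun j => a j - a' j) Pd.
    move=> i x /e /eqP; rewrite -subr_eq0 => /eqP <-; rewrite /enriched_flux.
    under eq_bigr do rewrite mulrBl.
    by rewrite sumrB dotC dotBr !(dotC (nu i)) opprD addrACA.
  by move=> pp aa; split=> [x|j]; apply/eqP; rewrite -subr_eq0; apply/eqP.
split.
- move=> p a Pp u0.
  (* The zero field agrees with two enriched fields on the solid, so their fluxes
     are equal. *)
  have P0 : P1_field R (fun=> 0).
    move=> l; have := @P1_cst R 0; congr (P1 R _).
    by apply/funext => x; rewrite mxE.
  have [|pp aa] := inj p a (fun=> 0) (fun=> 0) Pp P0; last by split.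
  move=> i x fx; apply: (traceU i (fun=> 0)) fx; [exact: fluxP1|exact: fluxP1| |].
    by apply: trace => // y /u0 ->.
  apply: trace => // y _; rewrite /enriched_field add0r big1 // => j _.
  by rewrite scale0r.
- move=> _ [p [a [Pp ->]]].
  have tr := traceR p a Pp.
  exists (fun i => restr (face v i) (enriched_flux v nu p a i)); split.
    split; first by move=> i; exists (enriched_flux v nu p a i) => //; exact: fluxP1.
    move=> i; apply: eq_normal_trace (tr i) => x; rewrite inE => fx.
    by rewrite restr_in.
  move=> g [Pg ug]; apply/funext => i; have [q Pq gq] := Pg i.
  rewrite gq; apply: eq_restr => x fx.
  apply: (traceU i _ _ _ _ _ (tr i)) fx => //; first exact: fluxP1.
  apply: eq_normal_trace (ug i) => y; rewrite inE => fy.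
  by rewrite gq restr_in.
- move=> g Pg.
  have /choice[q qP] : forall i, exists q, P1 R q /\ g i = restr (face v i) q.
    by move=> i; have [q] := Pg i; exists q.
  have [p [a [Pp pa]]] := enriched_flux_surj hexahedron_v normalized_v invertible
    (fun i => (qP i).1).
  exists (restr (solid v) (enriched_field sigma p a)); split.
    split; first by exists p, a.
    move=> i; apply: eq_normal_trace (traceR p a Pp i) => x; rewrite inE => fx.
    by rewrite (qP i).2 restr_in // pa.
  move=> _ [[p' [a' [Pp' ->]]] ug].
  have [|pp aa] := inj p a p' a' Pp Pp'.
    move=> i x fx; rewrite pa //; symmetry.
    apply: (traceU i _ _ _ _ _ (traceR p' a' Pp' i)) fx; [exact: fluxP1|exact: (qP i).1|].
    apply: eq_normal_trace (ug i) => y; rewrite inE => fy.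
    by rewrite (qP i).2 restr_in.
  apply: eq_restr => x _; rewrite /enriched_field pp.
  by congr (_ + _); apply: eq_bigr => j _; rewrite aa.
Qed.
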